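(* Let $V$ be a left vector space over a division ring $R$, of finite dimension $n\ge 2$. Let $G$ be a subgroup of $\mathrm{GL}(V)$ isomorphic to the symmetric group $S_{m}$. Let $X\subset V$ be an orbit of $G$ such that $G$ acts faithfully on $X$ and $|X|=m$. Suppose that there are no $G$-invariant subspaces of $V$ other than $\{0\}$ and $V$. Then the following assertions hold: (1) $X$ is a base of $V$, or $X=\{x_{1},\dots,x_{n},-(x_{1}+\dots+x_{n})\}$, where $x_{1},\dots,x_{n}$ form a base of $V$; (2) $G=G(X)$.
   Context: $S_m$ is the group of permutations of $m$ letters. For a set $X$, $S(X)$ denotes the group of all permutations of $X$. Let $X$ be a finite subset of $V$ with $|X|\ge 2$ whose linear span is $V$ and such that every permutation of $X$ can be extended to a linear automorphism of $V$. Then every $s\in S(X)$ has a unique extension $\alpha_{X}(s)\in\mathrm{GL}(V)$ (i.e. $\alpha_X(s)(x)=s(x)$ for all $x\in X$), and $\alpha_{X}:S(X)\to\mathrm{GL}(V)$ is an injective group homomorphism. Its image is denoted by $G(X)$. The assertion $G=G(X)$ includes the assertion that $X$ satisfies these conditions, so that $G(X)$ is defined. *)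

(* Defs.v *)
From HB Require Import structures.
From mathcomp Require Import all_boot all_order all_algebra all_fingroup finmap.

Set Implicit Arguments.
Unset Strict Implicit.
Unset Printing Implicit Defensive.

Import GRing.Theory.
Local Open Scope ring_scope.

(* The base ring is an arbitrary [nzRingType], possibly noncommutative, so the
   subspace theory of vector.v, which needs a commutative field, does not apply.
   [vectType R], [dim] and ['End(V)] do make sense over such a ring. *)

(* An automorphism is stored together with its inverse, so that GL(V) is a
   [subType] with decidable equality whatever the base ring. *)
Record GL (R : nzRingType) (V : vectType R) := MkGL {
  GLpair : 'End(V) * 'End(V);
  _ : ((GLpair.1 \o GLpair.2)%VF == \1%VF) && ((GLpair.2 \o GLpair.1)%VF == \1%VF)
}.
Arguments GL {R} V.

HB.instance Definition _ (R : nzRingType) (V : vectType R) :=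
  [isSub for @GLpair R V].
HB.instance Definition _ (R : nzRingType) (V : vectType R) :=
  [Choice of GL V by <:].

Definition GLfun (R : nzRingType) (V : vectType R) (g : GL V) : V -> V :=
  (GLpair g).1.
Coercion GLfun : GL >-> Funclass.

Section GLGroup.
Variables (R : nzRingType) (V : vectType R).
Implicit Types (f g : GL V) (p q : 'End(V)).

Lemma GLpairP g :
  ((GLpair g).1 \o (GLpair g).2)%VF = \1%VF /\
  ((GLpair g).2 \o (GLpair g).1)%VF = \1%VF.
Proof. by case: g => [[p q] /=] /andP[/eqP ? /eqP ?]. Qed.

Lemma GLP f g : f =1 g <-> f = g.
Proof.
split=> [eq_fg|-> //]; have [fV Vf] := GLpairP f; have [gV Vg] := GLpairP g.
apply: val_inj; rewrite /= [GLpair f]surjective_pairing.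
rewrite [GLpair g]surjective_pairing.
have e1 : (GLpair f).1 = (GLpair g).1 by apply/lfunP.
congr (_, _) => //; rewrite -[LHS]comp_lfun1r -gV comp_lfunA -e1 Vf.
by rewrite comp_lfun1l.
Qed.

Lemma GL_bij g : bijective g.
Proof.
have [gV Vg] := GLpairP g.
by exists (GLpair g).2 => v; rewrite /GLfun -comp_lfunE ?gV ?Vg id_lfunE.
Qed.

Lemma GL_of_bij p : bijective p -> exists g : GL V, g =1 p.
Proof.
case=> q pK qK.
have lin_q : linear q.
  by move=> a u v; apply: (can_inj pK); rewrite linearP /= !qK.
pose qL := GRing.isLinear.Build R V V *:%R q lin_q.
pose Q : {linear V -> V} := HB.pack q qL.
have pQ : ((p \o linfun Q)%VF == \1%VF) && ((linfun Q \o p)%VF == \1%VF).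
  apply/andP; split; apply/eqP/lfunP=> v; rewrite comp_lfunE id_lfunE lfunE /=.
    exact: qK.
  exact: pK.
by exists (@MkGL R V (p, linfun Q) pQ).
Qed.

Fact GLone_subproof :
  ((\1 \o \1)%VF == \1%VF :> 'End(V)) && ((\1 \o \1)%VF == \1%VF :> 'End(V)).
Proof. by rewrite comp_lfun1l eqxx. Qed.
Definition GLone : GL V := @MkGL R V (\1%VF, \1%VF) GLone_subproof.

Fact GLinv_subproof g :
  (((GLpair g).2 \o (GLpair g).1)%VF == \1%VF) &&
  (((GLpair g).1 \o (GLpair g).2)%VF == \1%VF).
Proof. by have [-> ->] := GLpairP g; rewrite eqxx. Qed.
Definition GLinv g : GL V :=
  @MkGL R V ((GLpair g).2, (GLpair g).1) (GLinv_subproof g).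

Fact GLmul_subproof f g :
  ((((GLpair g).1 \o (GLpair f).1) \o ((GLpair f).2 \o (GLpair g).2))%VF
     == \1%VF) &&
  ((((GLpair f).2 \o (GLpair g).2) \o ((GLpair g).1 \o (GLpair f).1))%VF
     == \1%VF).
Proof.
have [fV Vf] := GLpairP f; have [gV Vg] := GLpairP g.
rewrite -comp_lfunA (comp_lfunA (GLpair f).1) fV comp_lfun1l gV eqxx /=.
by rewrite -comp_lfunA (comp_lfunA (GLpair g).2) Vg comp_lfun1l Vf eqxx.
Qed.

(* As for permutations in perm.v, [f * g] means "first f, then g". *)
Definition GLmul f g : GL V :=
  @MkGL R V (((GLpair g).1 \o (GLpair f).1)%VF, ((GLpair f).2 \o (GLpair g).2)%VF)
    (GLmul_subproof f g).

Lemma GLoneE v : GLone v = v.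
Proof. exact: id_lfunE. Qed.
Lemma GLmulE f g v : GLmul f g v = g (f v).
Proof. exact: comp_lfunE. Qed.
Lemma GLinvK g : cancel (GLinv g) g.
Proof. by have [gV _] := GLpairP g => v; rewrite /GLfun -comp_lfunE gV id_lfunE. Qed.
Lemma GLKinv g : cancel g (GLinv g).
Proof. by have [_ Vg] := GLpairP g => v; rewrite /GLfun -comp_lfunE Vg id_lfunE. Qed.

Fact GLmulA : associative GLmul.
Proof. by move=> f g h; apply/GLP => v; rewrite !GLmulE. Qed.
Fact GLmul1g : left_id GLone GLmul.
Proof. by move=> f; apply/GLP => v; rewrite !GLmulE GLoneE. Qed.
Fact GLmulg1 : right_id GLone GLmul.
Proof. by move=> f; apply/GLP => v; rewrite !GLmulE GLoneE. Qed.
Fact GLmulVg : left_inverse GLone GLinv GLmul.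
Proof. by move=> f; apply/GLP => v; rewrite GLmulE GLinvK GLoneE. Qed.
Fact GLmulgV : right_inverse GLone GLinv GLmul.
Proof. by move=> f; apply/GLP => v; rewrite GLmulE GLKinv GLoneE. Qed.

HB.instance Definition _ :=
  isGroup.Build (GL V) GLmulA GLmul1g GLmulg1 GLmulVg GLmulgV.

Lemma GL1E v : (1%g : GL V) v = v.
Proof. exact: GLoneE. Qed.
Lemma GLME f g v : (f * g)%g v = g (f v).
Proof. exact: GLmulE. Qed.

Fact GL_is_linear g : linear g.
Proof. by move=> a u v; rewrite /GLfun linearP. Qed.
HB.instance Definition _ (g : GL V) :=
  GRing.isLinear.Build R V V _ g (GL_is_linear g).

End GLGroup.

Definition isomorphic_to (H K : groupType) (G : {pred K}) : Prop :=
  exists phi : {multiplicative H -> K},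
    injective phi /\ forall g : K, g \in G <-> exists h : H, phi h = g.

Definition spans (R : nzRingType) (V : lmodType R) (I : finType) (x : I -> V) :=
  forall v : V, exists c : I -> R, v = \sum_i c i *: x i.

Definition lin_indep (R : nzRingType) (V : lmodType R) (I : finType)
    (x : I -> V) :=
  forall c : I -> R, \sum_i c i *: x i = 0 -> forall i, c i = 0.

Definition is_base (R : nzRingType) (V : lmodType R) (I : finType) (x : I -> V) :=
  lin_indep x /\ spans x.

Definition set_base (R : nzRingType) (V : lmodType R) (X : {fset V}) :=
  is_base (fun x : X => val x).

Section ActionOnV.
Variables (R : nzRingType) (V : vectType R).

Definition is_orbit (G : {pred GL V}) (X : {fset V}) :=
  exists v : V, forall w : V, w \in X <-> exists2 g, g \in G & w = g v.

Definition faithful_on (G : {pred GL V}) (X : {fset V}) :=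
  {in G, forall g : GL V, (forall x, x \in X -> g x = x) -> g = 1%g}.

Definition invariant (G : {pred GL V}) (W : {pred V}) :=
  {in G & W, forall (g : GL V) (w : V), g w \in W}.

Definition no_proper_invariant_subspace (G : {pred GL V}) :=
  forall W : {pred V}, submod_closed W -> invariant G W ->
    W =i pred1 0 \/ W =i predT.

End ActionOnV.

Section PermutationExtension.
Variables (R : nzRingType) (V : vectType R) (X : {fset V}).

Definition extends (s : {perm X}) (g : GL V) :=
  [forall x : X, g (val x) == val (s x)].

Definition admissible :=
  [/\ (2 <= #|` X|)%N, spans (fun x : X => val x)
    & forall s : {perm X}, exists g : GL V, extends s g].

Lemma extension_exists : admissible ->
  forall s : {perm X}, exists g : GL V, extends s g.
Proof. by case. Qed.

Definition alpha (hX : admissible) (s : {perm X}) : GL V :=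
  xchoose (extension_exists hX s).

Variable hX : admissible.

Lemma alphaE (s : {perm X}) (x : X) : alpha hX s (val x) = val (s x).
Proof. by have /forallP/(_ x)/eqP := xchooseP (extension_exists hX s). Qed.

Lemma alpha_unique (s : {perm X}) (g : GL V) :
  (forall x : X, g (val x) = val (s x)) -> g = alpha hX s.
Proof.
move=> gE; have [_ spX _] := hX; apply/GLP => v.
have [c ->] := spX v; rewrite !linear_sum; apply: eq_bigr => x _.
by rewrite !linearZ /= gE alphaE.
Qed.

Lemma alphaM : {morph alpha hX : s t / (s * t)%g}.
Proof.
by move=> s t; apply/esym/alpha_unique => x; rewrite GLME !alphaE permM.
Qed.

Lemma alpha_inj : injective (alpha hX).
Proof. by move=> s t est; apply/permP => x; apply: val_inj; rewrite -!alphaE est. Qed.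

Definition GX : {pred GL V} := [pred g | [exists s : {perm X}, alpha hX s == g]].

End PermutationExtension.

(* The assertion G = G(X), including that G(X) is defined. *)
Definition is_G_of (R : nzRingType) (V : vectType R) (G : {pred GL V})
    (X : {fset V}) :=
  exists hX : admissible X, G =i GX hX.

(* Main.v *)
Require Import Defs.
From HB Require Import structures.
From mathcomp Require Import all_boot all_order all_algebra all_fingroup finmap.
From mathcomp Require boolp.
Import GRing.Theory VectorInternalTheory.
Local Open Scope ring_scope.

(** A faithful action of a group of order [m!] on an [m]-element set [X] induces
    all permutations of [X], and [X] spans [V] by irreducibility; this gives
    [G = G(X)].  If a linear relation on [X] had two different coefficients [c_a]
    and [c_b], then subtracting its image under the transposition [(a b)] would
    yield [(c_a - c_b)(a - b) = 0], hence [a = b].  So the relations on [X] are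
    the multiples of [\sum_(x in X) x] by scalars: either there are none, or
    [X] sums to [0] and becomes a base when one element is removed. *)

(** Gaussian elimination, by induction on the number [k] of equations. Unknowns multiply from the
    left, so rows are reduced by left multiples of a pivot row, and the pivot is inverted on the
    right. *)
Lemma homogeneous_system (R : unitRingType)
    (hR : forall x : R, x != 0 -> x \is a GRing.unit)
    (k n : nat) (A : 'I_n -> 'I_k -> R) : (k < n)%N ->
  exists2 c : 'I_n -> R, exists i, c i != 0 & forall j, \sum_i c i * A i j = 0.
Proof.
elim: k n A => [|k IHk] [//|n] A lt_kn.
  by exists (fun=> 1) => [|[]//]; exists ord0; rewrite oner_neq0.
have [i0 nzA|A0] := pickP (fun i => A i ord0 != 0); last first.
  have [c nzc c0] := IHk n.+1 (fun i j => A i (lift ord0 j)) (ltnW lt_kn).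
  exists c => // j; case: (unliftP ord0 j) => [j' ->|->]; first exact: c0.
  by apply: big1 => i _; have /negbFE/eqP-> := A0 i; rewrite mulr0.
pose B i := A (lift i0 i) ord0 * (A i0 ord0)^-1.
have [c [i1 nzc] c0] :=
  IHk n (fun i j => A (lift i0 i) (lift ord0 j) - B i * A i0 (lift ord0 j)) lt_kn.
(* The value at the pivot [i0] is chosen so that [d] solves the original system exactly when [c]
   solves the reduced one, in which column [ord0] has become zero. *)
pose d i := if unlift i0 i is Some i' then c i' else - \sum_i' c i' * B i'.
exists d; first by exists (lift i0 i1); rewrite /d liftK.
move=> j; have -> : \sum_i d i * A i j
    = \sum_i c i * (A (lift i0 i) j - B i * A i0 j).
  rewrite (bigD1_ord i0) //= /d unlift_none mulNr mulr_suml addrC -sumrB.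
  by apply: eq_bigr => i _; rewrite liftK mulrBr (mulrA _ (B i)).
case: (unliftP ord0 j) => [j' ->|->]; first exact: c0.
by apply: big1 => i _; rewrite /B mulrVK ?hR // subrr mulr0.
Qed.

(** Write each [y j] in terms of [x]. If [J] were larger than [I], the coefficient matrix would have
    a nontrivial left relation between its rows, hence so would [y]. *)
Lemma indep_le_span (R : unitRingType)
    (hR : forall x : R, x != 0 -> x \is a GRing.unit)
    (V : lmodType R) (I J : finType) (x : I -> V) (y : J -> V) :
  spans x -> lin_indep y -> (#|J| <= #|I|)%N.
Proof.
move=> spx indy; rewrite leqNgt; apply/negP => ltIJ.
have [a yE] := fin_all_exists (fun j => spx (y j)).
have [c [p nzc] c0] :=
  homogeneous_system R hR _ _ (fun p q => a (enum_val p) (enum_val q)) ltIJ.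
have /indy/(_ (enum_val p))/eqP : \sum_j c (enum_rank j) *: y j = 0.
  under eq_bigr => j _ do rewrite yE scaler_sumr.
  rewrite exchange_big big1 // => i _.
  under eq_bigr => j _ do rewrite scalerA.
  rewrite -scaler_suml (_ : \sum_j _ = 0) ?scale0r //.
  rewrite -[RHS](c0 (enum_rank i)) (reindex _ (onW_bij _ (enum_val_bij J))).
  by apply: eq_bigr => q _; rewrite enum_valK enum_rankK.
by rewrite enum_valK (negbTE nzc).
Qed.

(** Transports the standard base of row vectors along [r2v], which ties [dim V] to the size of a
    base. *)
Lemma is_base_delta (R : nzRingType) (V : vectType R) :
  is_base (fun i : 'I_(dim V) => r2v (delta_mx 0 i) : V).
Proof.
pose f : {linear 'rV[R]_(dim V) -> V} := @r2v R V.
have sumE (c : 'I_(dim V) -> R) :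
    \sum_i c i *: f (delta_mx 0 i) = f (\row_i c i).
  rewrite [\row_i c i]row_sum_delta linear_sum; apply: eq_bigr => i _.
  by rewrite linearZ mxE.
split=> [c|v].
  rewrite sumE -[RHS](linear0 f).
  by move=> /r2v_inj/rowP c0 i; have := c0 i; rewrite !mxE.
exists (fun i => v2r v 0 i); rewrite sumE.
rewrite -[LHS]v2rK; congr (f _).
by apply/rowP => i; rewrite mxE.
Qed.

Lemma card_base (R : unitRingType)
    (hR : forall x : R, x != 0 -> x \is a GRing.unit)
    (V : vectType R) (I : finType) (x : I -> V) : is_base x -> #|I| = dim V.
Proof.
move=> [indx spx]; have [inde spe] := is_base_delta R V.
apply/eqP; rewrite -[dim V]card_ord eqn_leq.
rewrite (indep_le_span _ hR _ _ _ _ _ spe indx).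
by rewrite (indep_le_span _ hR _ _ _ _ _ spx inde).
Qed.

(** The span of the family is invariant, since [G] maps members to members, and it is not zero. *)
Lemma irreducible_spans (R : nzRingType) (V : vectType R) (G : {pred GL V})
    (I : finType) (x : I -> V) :
  no_proper_invariant_subspace G ->
  (forall g, g \in G -> forall i, exists j, g (x i) = x j) ->
  (exists i, x i != 0) -> spans x.
Proof.
move=> irrG stx [i0 nzx].
pose P v := exists c : I -> R, v = \sum_i c i *: x i.
(* A subspace is a boolean predicate here, so membership in the span is decided classically. *)
pose W : {pred V} := fun v => boolp.asbool (P v).
have WP v : reflect (P v) (v \in W) by exact: boolp.asboolP.
have Wsub : submod_closed W.
  split=> [|a u v /WP[c ->] /WP[d ->]]; apply/WP.
    by exists (fun=> 0); rewrite big1 // => i _; rewrite scale0r.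
  exists (fun i => a * c i + d i); rewrite scaler_sumr -big_split /=.
  by apply: eq_bigr => i _; rewrite scalerA scalerDl.
have Wx i : x i \in W.
  apply/WP; exists (fun j => (j == i)%:R); rewrite (bigD1 i) //= eqxx scale1r.
  by rewrite big1 ?addr0 // => j /negbTE->; rewrite scale0r.
have WG : Defs.invariant G W.
  move=> g v Gg /WP[c ->]; rewrite linear_sum.
  have [W0 WD] := Wsub; apply: (big_ind (fun u => u \in W)) => // [u w|i _].
    by move=> Wu Ww; rewrite -[u]scale1r WD.
  by have [j gx] := stx g Gg i; rewrite linearZ /= gx -[_ *: _]addr0 WD.
case: (irrG W Wsub WG) => WE v; last by apply/WP; rewrite WE.
by move: (WE (x i0)); rewrite Wx inE (negbTE nzx).
Qed.

Lemma unit_scaler_eq0 (R : unitRingType) (V : lmodType R) (a : R) (v : V) :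
  a \is a GRing.unit -> a *: v = 0 -> v = 0.
Proof.
by move=> Ua av0; rewrite -[v]scale1r -(mulVr Ua) -scalerA av0 scaler0.
Qed.

Lemma relation_constant (R : unitRingType)
    (hR : forall x : R, x != 0 -> x \is a GRing.unit)
    (V : lmodType R) (I : finType) (x : I -> V) (c : I -> R) :
  injective x ->
  (forall s : {perm I}, exists g : {linear V -> V}, forall i, g (x i) = x (s i)) ->
  \sum_i c i *: x i = 0 -> forall a b, c a = c b.
Proof.
move=> injx ext cx0 a b; apply/eqP/negPn/negP; rewrite -subr_eq0 => nz_cab.
have neq_ab : a != b by apply: contraNneq nz_cab => ->; rewrite subrr.
have [g gx] := ext (tperm a b).
(* Apply [g] to the relation and reindex; the transposition is its own inverse. *)
have tcx0 : \sum_i c (tperm a b i) *: x i = 0.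
  have := congr1 g cx0; rewrite linear0 linear_sum => gcx0; rewrite -{}[RHS]gcx0.
  rewrite (reindex_inj (@perm_inj _ (tperm a b))).
  by apply: eq_bigr => i _; rewrite tpermK linearZ /= gx.
have /(unit_scaler_eq0 _ _ _ _ (hR _ nz_cab))/eqP :
    (c a - c b) *: (x a - x b) = 0.
  have : \sum_i c i *: x i - \sum_i c (tperm a b i) *: x i = 0.
    by rewrite cx0 tcx0 subrr.
  rewrite -sumrB (bigD1 a) // (bigD1 b) 1?eq_sym //= tpermL tpermR big1 => [|i].
    by rewrite addr0 -!scalerBl -[c b - c a]opprB scaleNr scalerBr.
  by move=> /andP[nia nib]; rewrite tpermD 1?eq_sym // subrr.
by rewrite subr_eq0 (inj_eq injx) (negbTE neq_ab).
Qed.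

(** A relation on the tail extends by the coefficient 0 at [ord0], and constancy then kills all its
    coefficients. For spanning, [y ord0] is minus the sum of the tail. *)
Lemma is_base_drop (R : nzRingType) (V : lmodType R) (k : nat)
    (y : 'I_k.+1 -> V) :
  spans y -> (forall c : 'I_k.+1 -> R, \sum_i c i *: y i = 0 ->
                forall i j, c i = c j) ->
  \sum_i y i = 0 -> is_base (fun i => y (lift ord0 i)).
Proof.
move=> spy consty sumy; split=> [c c0 i|v].
  pose d j := if unlift ord0 j is Some j' then c j' else 0.
  have := consty d; rewrite big_ord_recl /d unlift_none scale0r add0r.
  under eq_bigr => j _ do rewrite liftK.
  by move=> /(_ c0 (lift ord0 i) ord0); rewrite liftK unlift_none.
have [c ->] := spy v; exists (fun i => c (lift ord0 i) - c ord0).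
move: sumy; rewrite !big_ord_recl => /eqP; rewrite addr_eq0 => /eqP->.
rewrite scalerN scaler_sumr addrC -sumrB.
by apply: eq_bigr => i _; rewrite scalerBl.
Qed.

Local Open Scope fset_scope.

Theorem corollary1 (R : unitRingType) (hR : forall x : R, x != 0 -> x \is a GRing.unit)
  (V : vectType R) (n m : nat) (hdim : dim V = n) (hn : (2 <= n)%N)
  (G : {pred GL V}) (hG : group_closed G) (hGm : isomorphic_to 'S_m G)
  (X : {fset V}) (hX : is_orbit G X) (hfaith : faithful_on G X)
  (hcard : #|` X| = m) (hirr : no_proper_invariant_subspace G) :
  (set_base X \/
   exists x : 'I_n -> V,
     is_base x /\ X = [fset x i | i in 'I_n] `|` [fset - \sum_(i < n) x i]) /\
  is_G_of G X.
Proof.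
have [v0 orbX] := hX; have mulG := group_closedM hG.
have GX_in g x : g \in G -> x \in X -> g x \in X.
  move=> Gg /orbX[h Gh ->]; apply/orbX.
  by exists (h * g)%g; rewrite ?GLME // mulG.
have cardX : #|{: X}| = m by rewrite -hcard cardfE.
have [inde spe] := is_base_delta R V.
(* If [m <= 1], faithfulness makes [G] trivial, so the line through a base vector [e1] is invariant
   and [dim V <= 1]. *)
have m_gt1 : (1 < m)%N.
  rewrite ltnNge; apply/negP => m_le1.
  have /fintype_le1P X1 : (#|{: X}| <= 1)%N by rewrite cardX.
  have G_triv g : g \in G -> g = 1%g.
    move=> Gg; apply: hfaith => // x Xx.
    by have /(congr1 val) := X1 [` Xx] [` GX_in g x Gg Xx].
  have nz_dim : (0 < dim V)%N by rewrite hdim ltnW.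
  pose e1 : V := r2v (delta_mx 0 (Ordinal nz_dim)).
  have spe1 : spans (fun _ : unit => e1).
    apply: irreducible_spans hirr _ _ => [g /G_triv-> i|]; exists tt.
      by rewrite GL1E.
    apply/eqP => e1_0; have /eqP := oner_neq0 R; case.
    have := inde (fun i => (i == Ordinal nz_dim)%:R).
    rewrite (bigD1 (Ordinal nz_dim)) //= big1 => [|i /negbTE->]; last first.
      by rewrite scale0r.
    rewrite -/e1 e1_0 scaler0 addr0 => /(_ erefl (Ordinal nz_dim)).
    by rewrite eqxx.
  have := indep_le_span _ hR _ _ _ _ _ spe1 inde.
  by rewrite card_unit card_ord hdim leqNgt hn.
have actG g : g \in G -> exists s : {perm X}, forall x : X, g (val x) = val (s x).
  move=> Gg; pose f (x : X) : X := [` GX_in g (val x) Gg (valP x)].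
  have f_inj : injective f.
    by move=> x y /(congr1 val)/(bij_inj (GL_bij g))/val_inj.
  by exists (perm f_inj) => x; rewrite permE.
have spX : spans (fun x : X => val x).
  apply: irreducible_spans hirr _ _ => [g /actG[s gs] i|]; first by exists (s i).
  (* Of two distinct elements of [X], at least one is nonzero. *)
  have /card_gt1P[a [b [_ _]]] : (1 < #|{: X}|)%N by rewrite cardX.
  have [a0|nza _] := eqVneq (val a) 0; last by exists a.
  by rewrite -val_eqE a0 eq_sym => nzb; exists b.
have [phi [phi_inj phiG]] := hGm.
have Gphi h : phi h \in G by apply/phiG; exists h.
(* [r h] is the permutation of [X] induced by [phi h]. *)
have [r rE] := fin_all_exists (fun h => actG (phi h) (Gphi h)).
have r_inj : injective r.
  move=> h k rhk; apply/phi_inj/GLP => v; have [c ->] := spX v.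
  rewrite !linear_sum; apply: eq_bigr => x _.
  by rewrite !linearZ /= !rE rhk.
have card_permX : #|{perm X}| = m`!.
  rewrite -cardX -[#|{: X}|]cardsT -card_perm; apply: eq_card => s.
  by rewrite !inE; apply/esym/subsetP => x _; rewrite inE.
(* An injection between two sets of size [m!] is onto. *)
have r_onto s : exists h, r h = s.
  have := inj_card_onto r_inj _ s; rewrite card_permX card_Sn leqnn.
  by case/(_ isT)/codomP => h ->; exists h.
have extX (s : {perm X}) : exists2 g, g \in G & forall x : X, g (val x) = val (s x).
  by have [h <-] := r_onto s; exists (phi h).
have admX : admissible X.
  split=> // [|s]; first by rewrite hcard.
  by have [g _ gs] := extX s; exists g; apply/forallP => x; apply/eqP.
split; last first.
  exists admX => g; apply/idP/existsP => [/actG[s gs]|[s /eqP<-]].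
    by exists s; apply/eqP/esym/alpha_unique.
  by have [k Gk ks] := extX s; rewrite -(alpha_unique admX ks).
have ext_lin (s : {perm X}) :
    exists g : {linear V -> V}, forall x : X, g (val x) = val (s x).
  by have [g _ gs] := extX s; exists g.
have [indX|depX] := boolp.pselect (lin_indep (fun x : X => val x)).
  by left; split.
right.
have const_rel := relation_constant _ hR _ _ _ _ val_inj ext_lin.
(* A relation with common coefficient [c i] says that [c i] times the sum is 0. Were the sum
   nonzero, every relation would be trivial, against [depX]. *)
have sumX : \sum_(x : X) val x = 0.
  apply: boolp.contrapT => nz_sum; apply: depX => c c0 i.
  apply/eqP/negPn/negP => nz_ci; apply: nz_sum.
  apply: (unit_scaler_eq0 _ _ _ _ (hR _ nz_ci)); rewrite scaler_sumr -[RHS]c0.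
  by apply: eq_bigr => j _; rewrite (const_rel c c0 i j).
have [k mk] : exists k, m = k.+1 by exists m.-1; rewrite prednK // ltnW.
have [e e_bij] : exists e : 'I_k.+1 -> X, bijective e.
  have cardXk : #|{: X}| = k.+1 by rewrite cardX.
  exists (enum_val \o cast_ord (esym cardXk)).
  apply: bij_comp; first exact: enum_val_bij.
  by exists (cast_ord cardXk) => i; rewrite ?cast_ordK ?cast_ordKV.
pose y i := val (e i).
have y_sum (c : X -> R) : \sum_(x : X) c x *: val x = \sum_i c (e i) *: y i.
  by rewrite (reindex e) //; apply: onW_bij.
have [e' eK e'K] := e_bij.
have sum_y : \sum_i y i = 0.
  by rewrite -[RHS]sumX [RHS](reindex e) //; apply: onW_bij.
have base_y : is_base (fun i => y (lift ord0 i)).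
  apply: is_base_drop sum_y => [v|c c0 i j].
    by have [c ->] := spX v; exists (c \o e); rewrite y_sum.
  rewrite -[i]eK -[j]eK; apply: (const_rel (c \o e')).
  by rewrite y_sum -[RHS]c0; apply: eq_bigr => l _; rewrite /= eK.
(* The remaining [k] elements form a base, so [k] is the dimension. *)
have kn : k = n by rewrite -hdim -(card_base _ hR _ _ _ base_y) card_ord.
subst k.
have y0 : y ord0 = - \sum_i y (lift ord0 i).
  by move/eqP: sum_y; rewrite big_ord_recl addr_eq0 => /eqP.
exists (fun i => y (lift ord0 i)); split=> //.
apply/fsetP => v; rewrite in_fsetU in_fset1 -y0; apply/idP/orP => [Xv|].
  rewrite -[v]/(val [` Xv]) -[[` Xv]]e'K -/(y _).
  case: (unliftP ord0 (e' [` Xv])) => [i ->|->]; last by right.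
  by left; apply/imfsetP; exists i.
by case=> [/imfsetP[i _ ->]|/eqP->]; apply: valP.
Qed.
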